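(* Let $\beta$ be a Salem number, let $A$ be a finite subset of $\mathbb Q(\beta)$, and let $\Gamma$ be the sub-semigroup of the affine group of $\mathbb C$ generated by the maps $$x\mapsto \frac{x}{\beta}+t,\qquad t\in A.$$ Then $\dim_H(\Lambda_\Gamma)=\delta_\Gamma$.
   Context: A Salem number here is a real algebraic integer $\beta>1$ all of whose conjugates other than $\beta$ have modulus at most $1$. $\Gamma$ (the set of non-empty compositions of the generators) acts by isometries on the hyperbolic space $\mathbb H^3_{\mathbb R}=\{z+\tau j: z\in\mathbb C,\ \tau>0\}$ (upper half-space model, usual metric $d$ of curvature $-1$), the map $x\mapsto x/\beta+t$ acting by $z+\tau j\mapsto (z/\beta+t)+(\tau/|\beta|)j$. The boundary of $\mathbb H^3_{\mathbb R}$ is identified with $\mathbb C\cup\{\infty\}$. The critical exponent of $\Gamma$ is $\delta_\Gamma=\limsup_{n\to\infty}\frac1n\log\#\{x\in\Gamma o: d(o,x)\le n\}$, with base point $o=j$. The limit set $\Lambda_\Gamma$ is the set of limit points in $\mathbb C\cup\{\infty\}$ of the orbit $\Gamma o$; it is the subset of $\mathbb C$ consisting of the numbers $\sum_{k\ge0}t_k\beta^{-k}$ with $t_k\in A$. $\dim_H$ is Hausdorff dimension. *)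

(* Defs.v *)
From HB Require Import structures.
From mathcomp Require Import all_boot all_order all_algebra.
From mathcomp Require Import finmap.
From mathcomp Require Import complex.
From mathcomp Require Import all_classical all_reals all_analysis.

Set Implicit Arguments.
Unset Strict Implicit.
Unset Printing Implicit Defensive.

Import Order.TTheory GRing.Theory Num.Theory.
Import ComplexField.Normc.

Local Open Scope classical_set_scope.
Local Open Scope ring_scope.
Local Open Scope complex_scope.

(* Conjugates over Q: roots of the same irreducible rational polynomial. *)
Definition conjugate_over_rat (F : fieldType) (x y : F) : Prop :=
  exists p : {poly rat},
    [/\ irreducible_poly p, root (map_poly ratr p) x
      & root (map_poly ratr p) y].

(* Integers >= 2 and Pisot numbers are included. *)
Definition salem (R : realType) (b : R) : Prop :=
  [/\ 1 < b, integralOver (intr : int -> R) b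
    & forall z : R[i], conjugate_over_rat b%:C z -> z != b%:C -> normc z <= 1].

Definition rat_adjoin (F : fieldType) (x : F) : set F :=
  [set y | exists p q : {poly rat},
     (map_poly ratr q).[x] != 0 /\
     y = (map_poly ratr p).[x] / (map_poly ratr q).[x]].

(* [Affine a b _] is the map [x |-> a * x + b] of the affine group of C. *)
Record affine (R : realType) := Affine {
  lin : R[i];
  trans : R[i];
  lin_neq0 : lin != 0 }.

Definition aff_app (R : realType) (f : affine R) (x : R[i]) : R[i] :=
  lin f * x + trans f.

Definition aff_comp (R : realType) (f g : affine R) : affine R :=
  Affine (lin f * trans g + trans f) (mulf_neq0 (lin_neq0 f) (lin_neq0 g)).

Lemma aff_compE (R : realType) (f g : affine R) (x : R[i]) :
  aff_app (aff_comp f g) x = aff_app f (aff_app g x).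
Proof. by rewrite /aff_app /= mulrDr mulrA addrA. Qed.

Inductive generated_semigroup (R : realType) (G : set (affine R)) :
    affine R -> Prop :=
  | gs_gen f : G f -> generated_semigroup G f
  | gs_comp f g : generated_semigroup G f -> generated_semigroup G g ->
      generated_semigroup G (aff_comp f g).

Definition salem_semigroup (R : realType) (b : R) (A : set R[i]) :
    set (affine R) :=
  generated_semigroup [set f | lin f = (b%:C)^-1 /\ A (trans f)].

(* The pair [(z, t)] is the point [z + t j]. *)
Definition H3 (R : realType) := {x : R[i] * R | 0 < x.2}.

Definition H3_base (R : realType) : H3 R :=
  exist (fun x : R[i] * R => 0 < x.2) (0, 1) ltr01.

Definition arcosh (R : realType) (u : R) : R :=
  ln (u + Num.sqrt (u ^+ 2 - 1)).

Definition H3_dist (R : realType) (x y : H3 R) : R :=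
  arcosh (1 + (normc ((val x).1 - (val y).1) ^+ 2
               + ((val x).2 - (val y).2) ^+ 2)
              / (2 * (val x).2 * (val y).2)).

Lemma aff_act_subproof (R : realType) (f : affine R) (x : H3 R) :
  0 < normc (lin f) * (val x).2.
Proof.
rewrite mulr_gt0 ?(valP x)// lt_neqAle; apply/andP; split.
  by rewrite eq_sym; apply: contra (lin_neq0 f) => /eqP/eq0_normc/eqP.
by case: (lin f) => u v; exact: sqrtr_ge0.
Qed.

Definition aff_act (R : realType) (f : affine R) (x : H3 R) : H3 R :=
  exist (fun y : R[i] * R => 0 < y.2)
    (aff_app f (val x).1, normc (lin f) * (val x).2) (aff_act_subproof f x).

Definition base_orbit (R : realType) (Gamma : set (affine R)) : set (H3 R) :=
  [set aff_act f (H3_base R) | f in Gamma].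

(* [fset_set] is only meaningful on finite sets.  The sets counted here are
   finite whenever [Gamma] is generated by finitely many contractions: the
   height of the point given by a word decays exponentially with the length of
   the word.  [ln 0 = 0] only affects the empty [Gamma], for which the exponent
   is 0, in accordance with the dimension of the empty set. *)
Definition critical_exponent (R : realType) (Gamma : set (affine R)) : \bar R :=
  limn_esup (fun n : nat =>
    ((n%:R)^-1 *
     ln (#|` fset_set [set x | base_orbit Gamma x /\
                               H3_dist (H3_base R) x <= n%:R] |%:R))%:E).

(* The boundary C + {oo} is [option R[i]], with [None] for the point at
   infinity.  Neighbourhoods in the closed half-space: Euclidean half-balls at
   a complex number, complements of Euclidean half-balls at infinity. *)
Definition limit_set (R : realType) (Gamma : set (affine R)) :
    set (option R[i]) :=
  [set xi | match xi with
    | Some z => forall e : R, 0 < e -> exists2 x, base_orbit Gamma x &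
        Num.sqrt (normc ((val x).1 - z) ^+ 2 + (val x).2 ^+ 2) < e
    | None => forall M : R, exists2 x, base_orbit Gamma x &
        M < Num.sqrt (normc (val x).1 ^+ 2 + (val x).2 ^+ 2)
    end].

Section Hausdorff.
Variables (R : realType) (T : Type) (d : T -> T -> R).
Local Open Scope ereal_scope.

(* [-oo] on the empty set *)
Definition diameter (U : set T) : \bar R :=
  ereal_sup [set (d x y)%:E | x in U & y in U].

(* Convention for s = 0: a nonempty set counts for 1, the empty set for 0. *)
Definition diameter_pow (s : R) (U : set T) : \bar R :=
  if U == set0 then 0 else diameter U `^ s.

Definition hausdorff_premeasure (s delta : R) (E : set T) : \bar R :=
  ereal_inf [set \sum_(0 <= n <oo) diameter_pow s (U n) | U in
    [set U : nat -> set T | E `<=` \bigcup_n U n /\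
                            forall n, diameter (U n) <= delta%:E]].

Definition hausdorff_measure (s : R) (E : set T) : \bar R :=
  ereal_sup [set hausdorff_premeasure s delta E |
    delta in [set delta : R | (0 < delta)%R]].

Definition hausdorff_dim (E : set T) : \bar R :=
  ereal_inf [set s%:E |
    s in [set s : R | (0 <= s)%R /\ hausdorff_measure s E = 0]].

End Hausdorff.

(* Hausdorff dimension of a subset of C for the Euclidean metric. *)
Definition complex_hausdorff_dim (R : realType) (E : set R[i]) : \bar R :=
  hausdorff_dim (fun z w : R[i] => normc (z - w)) E.

(* A set of boundary points is measured through its part in C with the
   Euclidean metric; the single point at infinity has dimension 0 and does not
   change it. *)
Definition boundary_hausdorff_dim (R : realType) (L : set (option R[i])) :
    \bar R :=
  complex_hausdorff_dim [set z | L (Some z)].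

(* Main.v *)
Require Import Defs.
From mathcomp Require Import all_boot all_order all_algebra.
From mathcomp Require Import finmap.
From mathcomp Require Import complex.
From mathcomp Require Import all_classical all_reals all_analysis.
From mathcomp Require Import ring lra.

(** Write [S_m] for the set of sums of [t_k / beta ^ k] over [k < m], with
    digits [t_k] in [A] ([digit_sums]).  All these sums are real, since [A] lies
    in [Q(beta)].  The orbit of [j] is the set of points [s + beta ^ -m j] with
    [m > 0] and [s] in [S_m], and the distance of such a point from [j] is
    [m ln beta] up to a bounded error.  So the orbit grows like the cardinals
    [N_m] of the [S_m], and the critical exponent is the growth rate of [N_m]
    with respect to [beta ^ m].

    For [dim <= delta], the limit set is covered by [N_m] disks of radius
    [O (beta ^ -m)], centred at the points of [S_m]
    ([hausdorff_dim_limit_set_le]).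

    The inequality [delta <= dim] can only fail if many points of [S_m] lie at
    distance [o (beta ^ -m)] from each other, and the arithmetic of [beta] rules
    this out ([digit_sums_separated]).  After clearing denominators, the
    difference of two points of [S_m] is, up to a constant and the factor
    [beta ^ -m], the value at [beta] of an integer polynomial [P] of which the
    values on the closed unit disk are [O (m)].  The product of the values of
    [P] at all conjugates of [beta] is a non-zero integer, and each conjugate
    other than [beta] contributes at most [O (m)], so [P(beta)] is at least a
    negative power of [m].  Hence distinct points of [S_m] are
    [c beta ^ -m m ^ -e]-separated.

    A pigeonhole argument then gives a subset [T] of [S_m] with at least
    [N_m / O (m ^ e)] points, at mutual distances so large compared with
    [beta ^ -m] that expansions in base [beta ^ m] with digits in [T] form a
    Cantor set, which is contained in the limit set.  If [N_m] exceeds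
    [O (m ^ e) beta ^ (m t)] for a single [m], then [T] has more than
    [beta ^ (m t)] elements and this Cantor set has non-zero [t]-dimensional
    measure ([hausdorff_measure_neq0]); otherwise [delta <= t] by counting
    ([critical_exponent_le]).  The measure of the Cantor set is bounded below
    without constructing a measure on it: a cover of small [t]-sum would give
    words [w_n] in the alphabet [T] with the sum of [#|T| ^ - size w_n] less
    than 1, and by the Kraft inequality some infinite word has none of the
    [w_n] as a prefix ([kraft_avoid]). *)

Set Implicit Arguments.
Unset Strict Implicit.
Unset Printing Implicit Defensive.

Import Order.TTheory GRing.Theory Num.Theory.
Import ComplexField.Normc numFieldNormedType.Exports.

Local Open Scope classical_set_scope.
Local Open Scope ring_scope.
Local Open Scope complex_scope.

Local Notation "p ^intr" := (map_poly intr p) (at level 2, format "p ^intr").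

(** * Norms of values of integer polynomials *)

(** Factoring [P] into linear factors reduces this to [P = X - y], where the
    determinant is, up to sign, the value at [y] of the characteristic polynomial. *)
Lemma det_horner_mx (F : closedFieldType) n (M : 'M[F]_n.+1) (P : {poly F}) zs :
  char_poly M = \prod_(z <- zs) ('X - z%:P) ->
  \det (horner_mx M P) = \prod_(z <- zs) P.[z].
Proof.
move=> charM; have sz_zs : size zs = n.+1.
  by apply: succn_inj; rewrite -(size_prod_XsubC zs id) -charM size_char_poly.
have cst c : c ^+ n.+1 = \prod_(z <- zs) c.
  by rewrite big_const_seq count_predT sz_zs iter_mulr_1.
have det_sub y : \det (M - y%:M) = \prod_(z <- zs) (z - y).
  rewrite -[M - _]opprB -scaleN1r detZ.
  have -> : \det (y%:M - M) = (char_poly M).[y].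
    rewrite -/(horner_eval y _) /char_poly -det_map_mx; congr (\det _).
    by apply/matrixP => i j; rewrite !mxE rmorphB rmorphMn /= /horner_eval hornerX hornerC.
  rewrite charM horner_prod cst -big_split /=.
  by apply: eq_bigr => z _; rewrite !hornerE mulN1r opprB.
have [ys ->] := closed_field_poly_normal P; set a := lead_coef P.
rewrite horner_mxZ detZ rmorph_prod /=.
rewrite (big_morph _ (@det_mulmx _ _) (det1 _ _)).
under eq_bigr => y _ do rewrite rmorphB /= horner_mx_X horner_mx_C det_sub.
rewrite exchange_big /= cst -big_split /=.
apply: eq_bigr => z _; rewrite hornerZ horner_prod.
by congr (_ * _); apply: eq_bigr => y _; rewrite !hornerE.
Qed.

Lemma int_charpolyP (p : {poly int}) n :
  p \is monic -> size p = n.+2 -> exists M : 'M[int]_n.+1, char_poly M = p.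
Proof.
move=> mp sp; have := companionmxK mp.
by move: (companionmx p); rewrite sp /= => M hM; exists M.
Qed.

(** The product is the norm of [P] evaluated at a root of [p]: it is the determinant
    of [P] at an integer matrix with characteristic polynomial [p]. *)
Lemma int_prod_roots (F : numClosedFieldType) (p P : {poly int}) (zs : seq F) :
  p \is monic -> p^intr = \prod_(z <- zs) ('X - z%:P) ->
  exists k : int, \prod_(z <- zs) (P^intr).[z] = k%:~R.
Proof.
move=> mp pE.
have szp : size p = (size zs).+1.
  rewrite -(size_prod_XsubC zs id) -pE size_map_inj_poly ?rmorph0 //.
  exact: (@intr_inj F).
case: zs => [|z zs] in pE szp *; first by exists 1; rewrite big_nil.
have [M charM] := int_charpolyP mp szp.
exists (\det (horner_mx M P)).
rewrite -det_map_mx map_horner_mx; apply/esym/det_horner_mx.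
by rewrite -map_char_poly charM pE.
Qed.

Lemma ratr_intr_poly (F : numFieldType) (p : {poly int}) :
  map_poly (ratr : rat -> F) (p^intr) = p^intr.
Proof. by rewrite -map_poly_comp; apply: eq_map_poly => x /=; rewrite ratr_int. Qed.

Lemma irreducible_factor_root (F : numFieldType) (q : {poly rat}) (x : F) :
  q != 0 -> root (map_poly ratr q) x ->
  exists2 p : {poly rat}, irreducible_poly p & root (map_poly ratr p) x.
Proof.
have [n] := ubnP (size q); elim: n q => // n IH q szq q0 qx.
have [irrq|] := pselect (irreducible_poly q); first by exists q.
have sq1 : (1 < size q)%N.
  rewrite ltnNge; apply/negP => /size1_polyC qE; move: qx q0.
  by rewrite qE map_polyC rootC fmorph_eq0 polyC_eq0 => ->.
move=> nirr; have [d [sd dq ndq]] :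
    exists d : {poly rat}, [/\ size d != 1%N, d %| q & ~~ (d %= q)].
  apply: contrapT => H; apply: nirr; split => // d sd dq.
  by apply: contrapT => /negP nd; apply: H; exists d.
have [e qE] := dvdpP _ _ dq.
have e0 : e != 0 by apply: contraNneq q0 => e0; rewrite qE e0 mul0r.
have d0 : d != 0 by apply: contraNneq q0 => d0; rewrite qE d0 mulr0.
have szd : (size d < size q)%N.
  by rewrite ltn_neqAle dvdp_leq // andbT (dvdp_size_eqp dq).
have sze : (size e < size q)%N.
  rewrite qE size_mul //; move: sd; have : size d != 0%N by rewrite size_poly_eq0.
  by case: (size d) => [|[|k]] // _ _; rewrite !addnS /= ltnS leq_addr.
move: qx; rewrite qE rmorphM rootM => /orP [|] hx.
  by apply: (IH e) => //; apply: leq_trans sze _.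
by apply: (IH d) => //; apply: leq_trans szd _.
Qed.

Lemma irreducible_dvdp_root (F : numFieldType) (p q : {poly rat}) (x : F) :
  irreducible_poly p -> root (map_poly ratr p) x -> root (map_poly ratr q) x ->
  p %| q.
Proof.
move=> irrp px qx; have [cop|ncop] := boolP (coprimep p q).
  have /coprimep_root/(_ px) : coprimep (map_poly (ratr : rat -> F) p) (map_poly ratr q).
    by rewrite coprimep_map.
  by rewrite (rootP qx) eqxx.
have /(apply_irredp irrp) : size (gcdp p q) != 1%N by [].
by move=> /(_ (dvdp_gcdl _ _))/eqp_dvdl <-; exact: dvdp_gcdr.
Qed.

(** By Gauss's lemma, the primitive part of a rational irreducible factor of a monic
    integer polynomial has leading coefficient 1. *)
Lemma integral_min_poly (F : numFieldType) (x : F) :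
  integralOver (intr : int -> F) x ->
  exists p : {poly int}, [/\ p \is monic,
    irreducible_poly (p^intr : {poly rat}) & root p^intr x].
Proof.
move=> [q mq qx]; rewrite -ratr_intr_poly in qx.
have q0 : (q^intr : {poly rat}) != 0.
  by rewrite map_poly_eq0_id0 ?monic_neq0 // intr_eq0 lead_coef_eq0 monic_neq0.
have [p0 irr0 px] := irreducible_factor_root q0 qx.
have dvd0 := irreducible_dvdp_root irr0 px qx.
have [p [a a0 p0E]] := rat_poly_scale p0.
have aV0 : (a%:~R^-1 : rat) != 0 by rewrite invr_eq0 intr_eq0.
have irrp : irreducible_poly (p^intr : {poly rat}).
  case: irr0 => s0 irr0; split; first by move: s0; rewrite p0E size_scale.
  move=> d sd; rewrite -(dvdpZr d _ aV0) -p0E => /(irr0 _ sd) dp0.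
  by rewrite (eqp_trans dp0) // p0E eqp_scale.
have px' : root (map_poly ratr (p^intr : {poly rat})) x.
  by move: px; rewrite p0E map_polyZ rootZ // fmorph_eq0.
have dvdpq : p %| q by rewrite -dvdp_rat_int -(dvdpZl _ _ aV0) -p0E.
have [r qE] := dvdpP_int dvdpq.
have p00 : p != 0 by have := irredp_neq0 irrp; apply: contraNneq => ->; rewrite rmorph0.
have cp0 : zcontents p != 0 by rewrite zcontents_eq0.
have lead1 : lead_coef (zprimitive p) = 1.
  have := sgz_lead_primitive p; rewrite p00 => sgp.
  have /(congr1 (fun s : {poly int} => lead_coef s)) := qE; rewrite (eqP mq) lead_coefM.
  move=> lpr; have lp1 : `|lead_coef (zprimitive p)|%N = 1%N.
    have /(congr1 absz) := lpr; rewrite abszM => /esym/eqP.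
    by rewrite muln_eq1 => /andP [/eqP].
  by rewrite [LHS]intEsg lp1 sgp.
exists (zprimitive p); rewrite monicE lead1 eqxx; split=> //.
  have pz : (p^intr : {poly rat}) %= (zprimitive p)^intr.
    by rewrite {1}(zpolyEprim p) map_polyZ eqp_scale ?intr_eq0.
  case: irrp => sp irrp; split; first by rewrite -(eqp_size pz).
  move=> d sd dz; apply: (eqp_trans _ pz).
  by apply: irrp => //; rewrite (eqp_dvdr _ pz).
move: px'; rewrite ratr_intr_poly {1}(zpolyEprim p) map_polyZ rootZ //.
by rewrite intr_eq0.
Qed.

(** * Lower bound for integer polynomials at a Salem number *)

Lemma normc_real (R : realType) (x : R) : normc x%:C = `|x|.
Proof. by rewrite /normc /= expr0n addr0 sqrtr_sqr. Qed.

Lemma normc_ge0 (R : realType) (x : R[i]) : 0 <= normc x.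
Proof. by case: x => a b; exact: sqrtr_ge0. Qed.

Lemma normcX (R : realType) (x : R[i]) n : normc (x ^+ n) = normc x ^+ n.
Proof. by elim: n => [|n IH]; rewrite ?expr0 ?normc1 // !exprS normcM IH. Qed.

Lemma horner_intr_real (R : realType) (P : {poly int}) (x : R) :
  (P^intr).[x%:C] = ((P^intr).[x])%:C.
Proof.
rewrite -horner_map -map_poly_comp; congr (_.[_]).
by apply: eq_map_poly => k /=; rewrite rmorph_int.
Qed.

(** Let [zs] list the roots of the minimal polynomial of [beta]. The product of the
    values of [P] over [zs] is an integer, non-zero because [P] and the minimal
    polynomial have no common root. The roots other than [beta] lie in the unit disk
    and contribute a factor at most [B] each. *)
Lemma salem_poly_bound (R : realType) (beta : R) : salem beta ->
  exists d : nat, forall (P : {poly int}) (B : R), 1 <= B ->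
    (forall z : R[i], normc z <= 1 -> normc (P^intr).[z] <= B) ->
    (P^intr).[beta] != 0 -> 1 <= `|(P^intr).[beta]| * B ^+ d.
Proof.
move=> [b1 ib conj]; have [p [mp irrp pb]] := integral_min_poly ib.
have [zs] := closed_field_poly_normal (p^intr : {poly R[i]}).
rewrite lead_coef_map_inj ?rmorph0 //; last exact: intr_inj.
rewrite (eqP mp) scale1r => pE.
have pbC : root (p^intr : {poly R[i]}) beta%:C.
  by rewrite /root horner_intr_real (rootP pb) rmorph0.
have bzs : beta%:C \in zs by move: pbC; rewrite pE root_prod_XsubC.
have rootzs z : z \in zs -> root (p^intr : {poly R[i]}) z.
  by rewrite pE root_prod_XsubC.
exists (size (rem beta%:C zs)) => P B B1 PB Pb0.
have [k kE] := int_prod_roots P mp pE.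
have k1 : 1 <= normc (k%:~R : R[i]).
  have k0 : (k%:~R : R[i]) != 0.
    rewrite -kE prodf_seq_neq0; apply/allP => z /rootzs pz; rewrite implyTb.
    apply/negP => /eqP/rootP Pz; move/negP: Pb0; apply.
    have /dvdpP [r PE] : p^intr %| (P^intr : {poly rat}).
      by apply: (irreducible_dvdp_root irrp (x := z)); rewrite ratr_intr_poly.
    rewrite -[X in X.[_]]ratr_intr_poly PE rmorphM /= hornerM ratr_intr_poly.
    by rewrite (rootP pb) mulr0.
  rewrite -[k%:~R]/(k%:~R : R[i]) -(rmorph_int (real_complex R)) normc_real.
  rewrite -intr_norm ler1z -gtz0_ge1 normr_gt0.
  by apply: contraNneq k0 => ->.
(* If [beta] occurs again in the list, its factor is below 1 in the remaining case. *)
have [Pb1|Pb1] := leP 1 `|(P^intr).[beta]|.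
  by rewrite mulr_ege1 // exprn_ege1.
apply: le_trans k1 _; rewrite -kE (big_rem _ bzs) /= normcM horner_intr_real normc_real.
rewrite ler_wpM2l // (big_morph _ (@normcM _) (@normc1 _)).
have -> : B ^+ size (rem beta%:C zs) = \prod_(z <- rem beta%:C zs) B.
  by rewrite big_const_seq count_predT iter_mulr_1.
rewrite [leLHS]big_seq_cond [leRHS]big_seq_cond; apply: ler_prod => z.
rewrite andbT => /mem_rem zzs.
rewrite normc_ge0 /=; have [->|zb] := eqVneq z beta%:C.
  by rewrite horner_intr_real normc_real (le_trans (ltW Pb1)).
apply: PB; apply: conj zb; exists p^intr.
by rewrite !ratr_intr_poly; split=> //; exact: rootzs.
Qed.

Lemma poly_bounded_disc (R : realType) (P : {poly R[i]}) :
  exists2 B : R, 0 <= B & forall z, normc z <= 1 -> normc P.[z] <= B.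
Proof.
elim/poly_ind: P => [|P c [B B0 PB]].
  by exists 0 => // z _; rewrite horner0 normc0.
exists (B + normc c); first by rewrite addr_ge0 ?normc_ge0.
move=> z z1; rewrite hornerMXaddC; apply: le_trans (le_normcD _ _) _.
rewrite lerD2r normcM -[leRHS]mulr1 ler_pM ?normc_ge0 //; exact: PB.
Qed.

(** * Digit sums and their separation *)

(** The sums are built from the front: a new leading digit shifts the others by one
    power of [b]. With [m = 0] giving the empty sum, [digit_sums b A m] is the set of
    translations of words of length [m] for [m > 0]. *)
Fixpoint digit_sums (F : fieldType) (b : F) (A : set F) (m : nat) : set F :=
  if m is m'.+1 then [set a + s / b | a in A & s in digit_sums b A m']
  else [set 0].

Section DigitSums.
Variables (F : fieldType) (b : F) (A : set F).
Hypothesis b_neq0 : b != 0.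
Local Notation S := (digit_sums b A).

Lemma finite_digit_sums m : finite_set A -> finite_set (S m).
Proof.
move=> finA; elim: m => [|m IH] /=; first exact: finite_set1.
exact: finite_image2.
Qed.

Lemma digit_sumsD m k s s' : S m s -> S k s' -> S (m + k) (s + s' / b ^+ m).
Proof.
elim: m s => [|m IH] s /=; first by move=> -> Ss'; rewrite expr0 divr1 add0r.
move=> [a Aa [t Smt <-]] Ss'; exists a => //; exists (t + s' / b ^+ m); first exact: IH.
by rewrite exprS; field; rewrite b_neq0 expf_neq0.
Qed.

Lemma digit_sums_split m k s : S (m + k) s ->
  exists s1 s2, [/\ S m s1, S k s2 & s = s1 + s2 / b ^+ m].
Proof.
elim: m s => [|m IH] s /=; first by move=> Ss; exists 0, s; rewrite expr0 divr1 add0r.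
move=> [a Aa [t /IH [s1 [s2 [S1 S2 ->]]] <-]].
exists (a + s1 / b), s2; split=> //; first by exists a => //; exists s1.
by rewrite exprS; field; rewrite b_neq0 expf_neq0.
Qed.

End DigitSums.

(** The constant is the sum of the geometric series that bounds all expansions. *)
Lemma digit_sums_bounded (R : realType) (b : R) (A : set R) :
  1 < b -> finite_set A ->
  exists2 C : R, 0 < C & forall m s, digit_sums b A m s -> `|s| <= C.
Proof.
move=> b1 finA; have b0 : 0 < b by apply: lt_trans b1.
have [a0 a0_gt0 aP] : exists2 a0 : R, 0 < a0 & forall a, A a -> `|a| <= a0.
  have /finite_seqP [s ->] := finA; elim: s {finA} => [|a s [a0 a00 sP]]; first by exists 1.
  exists (a0 + `|a|) => [|y]; first by rewrite ltr_wpDr.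
  rewrite /= inE => /orP [/eqP ->|/sP h]; first by rewrite lerDr ltW.
  by rewrite (le_trans h) // lerDl.
have C0 : 0 < a0 * b / (b - 1) by rewrite divr_gt0 ?mulr_gt0 // subr_gt0.
exists (a0 * b / (b - 1)) => // m; elim: m => [|m IH] s /=.
  by move=> ->; rewrite normr0 ltW.
move=> [a Aa [t /IH ht <-]]; apply: le_trans (ler_normD _ _) _.
have -> : a0 * b / (b - 1) = a0 + (a0 * b / (b - 1)) / b.
  by field; rewrite gt_eqF // subr_eq0 gt_eqF.
rewrite lerD ?aP // normrM normfV (gtr0_norm b0).
by rewrite ler_wpM2r // invr_ge0 ltW.
Qed.

(** Clearing denominators in two steps, first those of the coefficients and then the
    denominators in [x], keeps everything in [Z[x]]. *)
Lemma rat_adjoin_common_denominator (F : numFieldType) (x : F) (A : set F) :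
  finite_set A -> A `<=` rat_adjoin x ->
  exists2 v : {poly int}, (v^intr).[x] != 0 &
    forall a, A a -> exists u : {poly int}, a * (v^intr).[x] = (u^intr).[x].
Proof.
move=> /finite_seqP [s ->]; elim: s => [_|a s IH sx].
  by exists 1 => //; rewrite rmorph1 hornerE oner_eq0.
have [|w w0 wP] := IH.
  by move=> y ys; apply: sx; rewrite /= inE ys orbT.
have [p [q [q0 ->]]] : rat_adjoin x a by apply: sx; rewrite /= mem_head.
have [p' [k k0 pE]] := rat_poly_scale p.
have [q' [l l0 qE]] := rat_poly_scale q.
have kF : (k%:~R : F) != 0 by rewrite intr_eq0.
have lF : (l%:~R : F) != 0 by rewrite intr_eq0.
have intrZ (c : int) (r : {poly int}) : ((c *: r)^intr).[x] = c%:~R * (r^intr).[x] :> F.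
  by rewrite map_polyZ hornerZ.
move: q0; rewrite pE qE !map_polyZ /= !hornerZ !ratr_intr_poly !fmorphV !rmorph_int => q0.
have q'0 : (q'^intr).[x] != 0 by apply: contraNneq q0 => ->; rewrite mulr0.
exists (k *: q' * w).
  by rewrite rmorphM hornerM /= intrZ !mulf_neq0.
move=> y; rewrite /= inE => /orP [/eqP ->|ys].
  exists (l *: p' * w); rewrite !rmorphM !hornerM /= !intrZ.
  by field; rewrite q'0 lF kF.
have [u uE] := wP _ ys.
exists (k *: q' * u); rewrite !rmorphM !hornerM /= mulrCA uE.
by [].
Qed.

(** With [V] a common denominator of [A], [V * beta ^+ m * s] is the value at [beta]
    of an integer polynomial with values of order [m] on the unit disk; the bound for
    Salem numbers applies to the difference of two such polynomials. *)
Lemma digit_sums_separated (R : realType) (beta : R) (A : set R) :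
  salem beta -> finite_set A -> A `<=` rat_adjoin beta ->
  exists c : R, exists2 e : nat, 0 < c & forall m s s', (0 < m)%N ->
    digit_sums beta A m s -> digit_sums beta A m s' -> s != s' ->
    c / (beta ^+ m * m%:R ^+ e) <= `|s - s'|.
Proof.
move=> sal finA Ab; have b0 : 0 < beta by case: sal => b1 _ _; apply: lt_trans b1.
have [d dP] := salem_poly_bound sal.
have [v v0 vP] := rat_adjoin_common_denominator finA Ab.
set V := (v^intr).[beta] in v0 vP.
have [B B1 BP] : exists2 B : R, 1 <= B & forall a, A a -> exists u : {poly int},
    a * V = (u^intr).[beta] /\
    forall z : R[i], normc z <= 1 -> normc (u^intr).[z] <= B.
  have /finite_seqP [s sE] := finA; move: vP; rewrite sE => {sE finA Ab}.
  elim: s => [_|a s IH sP]; first by exists 1.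
  have [|B B1 BP] := IH; first by move=> y ys; apply: sP; rewrite /= inE ys orbT.
  have [|u uE] := sP a; first by rewrite /= mem_head.
  have [B' B'0 uB] := @poly_bounded_disc R (u^intr).
  exists (B + B'); first by rewrite -[1]addr0 lerD.
  move=> y; rewrite /= inE => /orP [/eqP ->|/BP [w [wE wB]]].
    by exists u; split=> // z /uB h; rewrite -[leLHS]add0r lerD // (le_trans _ B1).
  by exists w; split=> // z /wB h; rewrite -[leLHS]addr0 lerD.
have numer m s : digit_sums beta A m s -> exists P : {poly int},
    V * beta ^+ m * s = (P^intr).[beta] /\
    forall z : R[i], normc z <= 1 -> normc (P^intr).[z] <= m%:R * B.
  elim: m s => [|m IH] s /=.
    by move=> ->; exists 0; split=> [|z _]; rewrite rmorph0 horner0 ?mulr0 // normc0 mul0r.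
  move=> [a Aa [t /IH [P [PE PB]] <-]]; have [u [uE uB]] := BP _ Aa.
  exists (u * 'X^(m.+1) + P); split.
    rewrite rmorphD rmorphM /= map_polyXn !hornerE ?hornerXn -uE -PE exprS.
    by field; rewrite gt_eqF.
  move=> z z1; rewrite rmorphD rmorphM /= map_polyXn !hornerE ?hornerXn.
  apply: le_trans (le_normcD _ _) _; rewrite mulrS mulrDl mul1r lerD ?PB //.
  rewrite normcM -[leRHS]mulr1 ler_pM ?normc_ge0 ?uB //.
  by rewrite normcX exprn_ile1 // normc_ge0.
exists (`|V| * (2 * B) ^+ d)^-1; exists d.
  by rewrite invr_gt0 mulr_gt0 ?normr_gt0 // exprn_gt0 // mulr_gt0 // (lt_le_trans _ B1).
move=> m s s' m0 /numer [P [PE PB]] /numer [P' [PE' PB']] ss'.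
have bm : 0 < beta ^+ m by rewrite exprn_gt0.
(* Both polynomials are bounded by [m * B], so their difference is bounded by
   [2 * B * m], which is at least 1 as the bound for Salem numbers requires. *)
have QE : ((P - P')^intr).[beta] = V * beta ^+ m * (s - s').
  by rewrite rmorphB /= hornerD hornerN -PE -PE' -mulrBr.
have m1 : 1 <= m%:R :> R by rewrite ler1n.
have : 1 <= `|V * beta ^+ m * (s - s')| * (2 * B * m%:R) ^+ d.
  rewrite -QE; apply: dP.
  - by rewrite !mulr_ege1 // ler1n.
  - move=> z z1; rewrite rmorphB /= hornerD hornerN.
    apply: le_trans (le_normcD _ _) _; rewrite normcN.
    have -> : 2 * B * m%:R = m%:R * B + m%:R * B by ring.
    by rewrite lerD ?PB ?PB'.
  - by rewrite QE !mulf_neq0 ?subr_eq0 // (gt_eqF bm).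
rewrite !normrM (gtr0_norm bm) exprMn => h.
have D0 : 0 < beta ^+ m * m%:R ^+ d by rewrite mulr_gt0 // exprn_gt0 // (lt_le_trans _ m1).
have E0 : 0 < `|V| * (2 * B) ^+ d.
  by rewrite mulr_gt0 ?normr_gt0 // exprn_gt0 // mulr_gt0 // (lt_le_trans _ B1).
rewrite ler_pdivrMr // -[leLHS]mul1r ler_pdivrMr //.
by apply: le_trans h _; rewrite le_eqVlt; apply/orP; left; apply/eqP; ring.
Qed.

(** * Orbit and limit set in terms of digit sums *)

Lemma exists_expr_lt (R : realType) (q eta : R) :
  0 <= q < 1 -> 0 < eta -> exists k : nat, q ^+ k < eta.
Proof.
move=> /andP [q0 q1] eta0.
have [k _ /(_ k (leqnn k)) qk] : \forall n \near \oo, `|q ^+ n| < eta.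
  by apply: cvgr0_norm_lt => //; apply: cvg_expr; rewrite ger0_norm.
by exists k; rewrite -[q ^+ k]ger0_norm // exprn_ge0.
Qed.

Lemma affine_ext (R : realType) (f g : affine R) :
  lin f = lin g -> trans f = trans g -> f = g.
Proof.
case: f g => [l t l0] [l' t' l'0] /= ll tt; move: l0 l'0; rewrite ll tt => l0 l'0.
by rewrite (bool_irrelevance l0 l'0).
Qed.

Section Orbit.
Variables (R : realType) (beta : R) (A : set R).
Hypothesis beta_gt1 : 1 < beta.
Local Notation S := (digit_sums beta A).
Local Notation Gamma := (salem_semigroup beta (real_complex R @` A)).

Let beta_gt0 : 0 < beta. Proof. exact: lt_trans beta_gt1. Qed.
Let beta_neq0 : beta != 0. Proof. by rewrite gt_eqF. Qed.
Let beta_neq0C : beta%:C != 0.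
Proof. by apply: contra beta_neq0 => /eqP h; apply/eqP; apply: complexI. Qed.

(** Composing maps concatenates their words of digits. *)
Lemma salem_semigroupP f : Gamma f <->
  exists2 m, (0 < m)%N & lin f = (beta%:C ^+ m)^-1 /\
    exists2 s, S m s & trans f = s%:C.
Proof.
split.
  elim=> {f} [f [lf [a Aa af]]|f g _ [m m0 [lf [s Ss fs]]] _ [k k0 [lg [s' Ss' gs']]]].
    exists 1%N => //; rewrite lf expr1; split=> //; exists a => //=.
    by exists a => //; exists 0; rewrite // mul0r addr0.
  exists (m + k)%N; first by rewrite addn_gt0 m0.
  rewrite /= lf lg fs gs' exprD invfM; split=> //.
  exists (s + s' / beta ^+ m); first exact: digit_sumsD.
  by rewrite rmorphD fmorph_div rmorphXn /= addrC mulrC.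
move=> [m m0 [lf [s Ss fs]]]; case: m m0 => // m _ in lf Ss *.
elim: m f s lf fs Ss => [|m IH] f s lf fs [a Aa [t St sE]].
  apply: gs_gen; split; first by rewrite lf expr1.
  by move: St => /= St; rewrite fs -sE St mul0r addr0; exists a.
have lg : (beta%:C ^+ m.+1)^-1 != 0 by rewrite invr_eq0 expf_neq0.
have la : (beta%:C)^-1 != 0 by rewrite invr_eq0.
have -> : f = aff_comp (Affine a%:C la) (Affine t%:C lg).
  apply: affine_ext => /=; first by rewrite lf -invfM -exprS.
  by rewrite fs -sE rmorphD fmorph_div /= addrC mulrC.
apply: gs_comp; last exact: (IH _ t).
by apply: gs_gen; split=> //; exists a.
Qed.

Let height_gt0 m : 0 < (beta ^+ m)^-1. Proof. by rewrite invr_gt0 exprn_gt0. Qed.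

Definition orbit_point m (s : R) : H3 R :=
  exist (fun x : R[i] * R => 0 < x.2) (s%:C, (beta ^+ m)^-1) (height_gt0 m).

Lemma orbit_point_inj m : injective (orbit_point m).
Proof. by move=> s s' /(congr1 (fun x : H3 R => complex.Re (val x).1)). Qed.

Lemma base_orbitP x : base_orbit Gamma x <->
  exists2 m, (0 < m)%N & (orbit_point m @` S m) x.
Proof.
have actE m s f : lin f = (beta%:C ^+ m)^-1 -> trans f = s%:C ->
    orbit_point m s = aff_act f (H3_base R).
  move=> lf fs; apply: val_inj; rewrite /= /aff_app mulr0 add0r fs mulr1 lf.
  by rewrite normcV normcX normc_real (gtr0_norm beta_gt0).
split=> [[f /salem_semigroupP [m m0 [lf [s Ss fs]]] <-]|[m m0 [s Ss <-]]].
  by exists m => //; exists s => //; apply: actE.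
have lg : (beta%:C ^+ m)^-1 != 0 by rewrite invr_eq0 expf_neq0.
exists (Affine s%:C lg); last by rewrite -(@actE m s).
by apply/salem_semigroupP; exists m => //; split=> //; exists s.
Qed.

Lemma dist_orbit_pointE m s :
  H3_dist (H3_base R) (orbit_point m s) =
  arcosh (1 + (s ^+ 2 + (1 - (beta ^+ m)^-1) ^+ 2) / (2 * (beta ^+ m)^-1)).
Proof.
rewrite /H3_dist (_ : _ - (val (orbit_point m s)).1 = (- s)%:C).
  by rewrite normc_real real_normK ?num_real // sqrrN mulr1.
by rewrite /= sub0r rmorphN.
Qed.

(** A point at height [h] is at distance at least [- ln h] from [j], with equality
    on the vertical axis. *)
Lemma dist_orbit_point_ge m s :
  m%:R * ln beta <= H3_dist (H3_base R) (orbit_point m s).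
Proof.
rewrite dist_orbit_pointE.
set h := _^-1; have h0 : 0 < h := height_gt0 m.
have h1 : h <= 1 by rewrite invf_le1 ?exprn_gt0 // exprn_ege1 // ltW.
set u := 1 + _.
have uE : u - (h + h^-1) / 2 = s ^+ 2 / (2 * h).
  by rewrite /u; field; rewrite gt_eqF.
have s0 : 0 <= s ^+ 2 / (2 * h) by rewrite divr_ge0 ?sqr_ge0 // mulr_ge0 // ltW.
have hu : (h + h^-1) / 2 <= u by rewrite -subr_ge0 uE.
have hV : h <= h^-1 by rewrite (le_trans h1) // invf_ge1.
have sq : (h^-1 - h) / 2 <= Num.sqrt (u ^+ 2 - 1).
  rewrite -[leLHS]ger0_norm; last by rewrite divr_ge0 // subr_ge0.
  rewrite -sqrtr_sqr ler_wsqrtr //.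
  have -> : ((h^-1 - h) / 2) ^+ 2 = ((h + h^-1) / 2) ^+ 2 - 1.
    by field; rewrite gt_eqF.
  have hh0 : 0 <= (h + h^-1) / 2 by rewrite divr_ge0 // addr_ge0 // ltW // invr_gt0.
  by rewrite lerB // lerXn2r ?nnegrE // (le_trans hh0).
have -> : m%:R * ln beta = ln (h^-1) by rewrite /h invrK lnXn // mulr_natl.
have hV0 : 0 < h^-1 by rewrite invr_gt0.
rewrite /arcosh ler_ln ?posrE //; first lra.
by apply: (lt_le_trans hV0); lra.
Qed.

(** Follows from [arcosh u <= ln (2 u)]. *)
Lemma dist_orbit_point_le C m s : `|s| <= C ->
  H3_dist (H3_base R) (orbit_point m s) <= m%:R * ln beta + ln (C ^+ 2 + 2).
Proof.
move=> sC; have C2 : s ^+ 2 <= C ^+ 2.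
  by rewrite -[s ^+ 2]real_normK ?num_real // lerXn2r // nnegrE ?(le_trans _ sC).
rewrite dist_orbit_pointE.
have b1 : 1 <= beta ^+ m by rewrite exprn_ege1 // ltW.
have b0 : 0 < beta ^+ m by rewrite exprn_gt0.
set b := beta ^+ m in b0 b1 *; set u := 1 + _.
have uE : 2 * u = s ^+ 2 * b + b + b^-1 by rewrite /u; field; rewrite gt_eqF.
have bV0 : 0 < b^-1 by rewrite invr_gt0.
have bV1 : b^-1 <= 1 by rewrite invf_le1.
have u1 : 1 <= u.
  rewrite /u lerDl; apply: divr_ge0; first by rewrite addr_ge0 ?sqr_ge0.
  by rewrite mulr_ge0 // ltW.
have sq : Num.sqrt (u ^+ 2 - 1) <= u.
  rewrite -[leRHS]ger0_norm ?(le_trans _ u1) // -sqrtr_sqr ler_wsqrtr //.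
  by rewrite gerBl.
have sq0 := sqrtr_ge0 (u ^+ 2 - 1).
have Cp : 0 < C ^+ 2 + 2 by rewrite ltr_wpDl ?sqr_ge0.
have -> : m%:R * ln beta + ln (C ^+ 2 + 2) = ln (b * (C ^+ 2 + 2)).
  by rewrite lnM ?posrE // lnXn // mulr_natl.
rewrite /arcosh ler_ln ?posrE ?mulr_gt0 //; last lra.
apply: (@le_trans _ _ (2 * u)); first lra.
rewrite uE; have : s ^+ 2 * b <= C ^+ 2 * b by rewrite ler_wpM2r // ltW.
by nra.
Qed.

(** An orbit point close to [z] has small height, hence comes from a word longer
    than [m]; the prefix of length [m] of that word gives [s]. *)
Lemma limit_set_cover C z m : (forall k s, S k s -> `|s| <= C) ->
  limit_set Gamma (Some z) ->
  exists2 s, S m s & normc (z - s%:C) <= (C + 1) / beta ^+ m.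
Proof.
move=> SC Lz; have bm0 : 0 < (beta ^+ m)^-1 by rewrite invr_gt0 exprn_gt0.
have [_ /base_orbitP [M M0 [s Ss <-]] /=] := Lz _ bm0.
set r := Num.sqrt _ => rlt.
have hM : (beta ^+ M)^-1 <= r.
  rewrite -[leLHS]ger0_norm ?(ltW (height_gt0 M)) // -sqrtr_sqr ler_wsqrtr // lerDr.
  by rewrite sqr_ge0.
have zM : normc (s%:C - z) <= r.
  rewrite -[leLHS]ger0_norm ?normc_ge0 // -sqrtr_sqr ler_wsqrtr // lerDl.
  by rewrite sqr_ge0.
have mM : (m <= M)%N.
  rewrite leqNgt; apply/negP => Mm.
  have := le_lt_trans hM rlt; rewrite ltf_pV2 ?posrE ?exprn_gt0 //.
  by rewrite ltr_eXn2l // ltnNge ltnW.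
move: Ss; rewrite -(subnKC mM) => /(digit_sums_split beta_neq0) [s1 [s2 [S1 S2 sE]]].
exists s1 => //.
have -> : z - s1%:C = - (s%:C - z) + (s2 / beta ^+ m)%:C.
  by rewrite sE rmorphD /=; ring.
apply: le_trans (le_normcD _ _) _; rewrite normcN mulrDl addrC lerD //.
  rewrite normc_real normrM ler_pM ?SC //.
  - by apply: SC S2.
  - by rewrite gtr0_norm.
by rewrite mul1r (le_trans zM) // ltW.
Qed.

Lemma limit_set_contains (K z : R) :
  (forall k, exists m s, [/\ (k <= m)%N, S m s & `|s - z| <= K / beta ^+ m]) ->
  limit_set Gamma (Some z%:C).
Proof.
move=> H e e0; have K0 : 0 <= K.
  have [m [s [_ _ h]]] := H 0%N; have := le_trans (normr_ge0 _) h.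
  by rewrite pmulr_lge0.
have K1 : 0 < K + 1 by rewrite ltr_wpDl.
have bV : 0 <= beta^-1 < 1 by rewrite invr_ge0 ltW //= invf_lt1.
have [k kP] := exists_expr_lt bV (divr_gt0 e0 K1).
have [m [s [km Ss h]]] := H k.+1.
exists (orbit_point m s).
  by apply/base_orbitP; exists m; [exact: leq_trans km|exists s].
have -> : (val (orbit_point m s)).1 - z%:C = (s - z)%:C by rewrite rmorphB.
rewrite normc_real [(val _).2]/=.
set hh := (beta ^+ m)^-1 in h *; have h0 : 0 < hh := height_gt0 m.
have hk : hh <= beta^-1 ^+ k.
  by rewrite exprVn lef_pV2 ?posrE ?exprn_gt0 // ler_eXn2l // ltnW.
apply: (@le_lt_trans _ _ ((K + 1) * hh)).
  rewrite -[leRHS]ger0_norm; last by rewrite mulr_ge0 // ltW.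
  rewrite -[leRHS]sqrtr_sqr ler_wsqrtr //.
  have a0 := normr_ge0 (s - z); nra.
by rewrite mulrC -ltr_pdivlMr //; apply: le_lt_trans kP.
Qed.

End Orbit.

(** * Exponential growth rates *)

Section GrowthRate.
Variables (R : realType) (c : nat -> nat).

Let rate : \bar R := limn_esup (fun n => ((n%:R)^-1 * ln (c n)%:R)%:E).

Lemma growth_rate_ge0 : (0 <= rate)%E.
Proof.
apply: limf_esup_ge0 => [|n]; first exact: filter_not_empty.
rewrite lee_fin mulr_ge0 ?invr_ge0 //.
have [->|c0] := posnP (c n); first by rewrite ln0.
by rewrite ln_ge0 // ler1n.
Qed.

Lemma growth_rate_le (s K : R) : 0 <= s -> 1 <= K ->
  (forall n, (0 < n)%N -> (c n)%:R <= K * expR (s * n%:R)) -> (rate <= s%:E)%E.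
Proof.
move=> s0 K1 cP; apply/lee_addgt0Pr => e e0.
have lnK0 : 0 <= ln K by rewrite ln_ge0.
pose n0 := Num.bound (ln K / e).
have n0P : ln K / e < n0%:R by apply: Num.Theory.archi_boundP; rewrite divr_ge0 // ltW.
apply: (@le_trans _ _ (ereal_sup
  [set ((n%:R)^-1 * ln (c n)%:R)%:E | n in [set n | (n0.+1 <= n)%N]])).
  by apply: ereal_inf_lbound; exists [set n | (n0.+1 <= n)%N] => //; exists n0.+1.
apply: ge_ereal_sup => _ [n /= n0n <-]; rewrite -EFinD lee_fin.
have np : 0 < n%:R :> R by rewrite ltr0n (leq_trans _ n0n).
rewrite mulrC ler_pdivrMr //.
have lnc : ln (c n)%:R <= ln K + s * n%:R.
  have [->|c0] := posnP (c n); first by rewrite ln0 // addr_ge0 // mulr_ge0 // ltW.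
  rewrite -[s * _]expRK -lnM ?posrE ?expR_gt0 // ?(lt_le_trans _ K1) //.
  rewrite ler_ln ?posrE ?ltr0n // ?mulr_gt0 ?expR_gt0 // ?(lt_le_trans _ K1) //.
  by apply: cP; rewrite (leq_trans _ n0n).
apply: le_trans lnc _; rewrite mulrDl addrC lerD2l.
rewrite mulrC -ler_pdivrMr //; apply: le_trans (ltW n0P) _.
by rewrite ler_nat ltnW.
Qed.

Lemma growth_rate_lt (s : R) : (rate < s%:E)%E ->
  exists2 n0, (0 < n0)%N & forall n, (n0 <= n)%N -> (c n)%:R <= expR (s * n%:R).
Proof.
move=> /ereal_inf_lt [_ [V [n0 _ n0V] <-] supV]; exists n0.+1 => // n n0n.
have [->|c0] := posnP (c n); first exact: expR_ge0.
have np : 0 < n%:R :> R by rewrite ltr0n (leq_trans _ n0n).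
rewrite -[leLHS]lnK ?posrE ?ltr0n // ler_expR -ler_pdivrMr // mulrC -lee_fin.
apply: ltW; apply: le_lt_trans supV; apply: ereal_sup_ubound; exists n => //.
by apply: n0V; apply: ltnW.
Qed.

End GrowthRate.

Lemma poly_le_expR (R : realType) (k : nat) (e : R) : 0 < e ->
  exists2 K : R, 0 < K & forall n : nat, n%:R ^+ k.+1 <= K * expR (e * n%:R).
Proof.
move=> e0; exists (k.+1`!%:R / e ^+ k.+1).
  by rewrite divr_gt0 ?exprn_gt0 // ltr0n fact_gt0.
move=> n; have en : 0 <= e * n%:R by rewrite mulr_ge0 // ltW.
have := expR_ge1Dxn k en; set E := expR _ => h.
have f0 : 0 < k.+1`!%:R :> R by rewrite ltr0n fact_gt0.
have {h} : (e * n%:R) ^+ k.+1 <= k.+1`!%:R * E.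
  rewrite [leRHS]mulrC -ler_pdivrMr //; apply: le_trans h.
  by rewrite lerDr.
rewrite exprMn => h; rewrite mulrAC ler_pdivlMr ?exprn_gt0 //.
by rewrite mulrC.
Qed.

(** * Counting orbit points *)

Lemma card_fset_set_image (T U : choiceType) (f : U -> T) (A : set T) (B : set U) :
  finite_set B -> A `<=` f @` B -> (#|` fset_set A| <= #|` fset_set B|)%N.
Proof.
move=> finB AB; have finfB : finite_set (f @` B) by exact: finite_image.
apply: (@leq_trans #|` fset_set (f @` B)|).
  by apply: fsubset_leq_card; rewrite -fset_set_sub //; exact: sub_finite_set AB _.
by rewrite fset_set_image //; exact: leq_imfset_card.
Qed.

Lemma card_fset_set_image_inj (T U : choiceType) (f : U -> T) (B : set U) :
  injective f -> finite_set B -> #|` fset_set (f @` B)| = #|` fset_set B|.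
Proof. by move=> finj finB; rewrite fset_set_image // card_imfset. Qed.

Section Counting.
Variables (R : realType) (beta : R) (A : set R).
Hypotheses (beta_gt1 : 1 < beta) (finA : finite_set A).
Local Notation S := (digit_sums beta A).
Local Notation N m := (#|` fset_set (S m)|).
Local Notation Gamma := (salem_semigroup beta (real_complex R @` A)).
Local Notation ball n :=
  [set x | base_orbit Gamma x /\ H3_dist (H3_base R) x <= n%:R].

Let finS m : finite_set (S m). Proof. exact: finite_digit_sums. Qed.
Let lnb_gt0 : 0 < ln beta. Proof. by rewrite ln_gt0. Qed.

(** [Y] collects the levels [1] to [L] of the orbit. Level 0, the point [j] given by
    the empty word, is left out since the semigroup need not contain the identity. *)
Let levels L : exists Y : set (H3 R), [/\ finite_set Y,
  forall m, (0 < m <= L)%N -> orbit_point beta_gt1 m @` S m `<=` Y &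
  (#|` fset_set Y| <= \sum_(i < L) N i.+1)%N].
Proof.
elim: L => [|L [Y [finY YP cardY]]].
  exists set0; split=> [//|m|]; first by case/andP => /leq_trans h /h.
  by rewrite fset_set0 cardfs0.
exists (Y `|` orbit_point beta_gt1 L.+1 @` S L.+1).
have finL : finite_set (orbit_point beta_gt1 L.+1 @` S L.+1) by exact: finite_image.
split=> [|m /andP [m0]|].
- by rewrite finite_setU.
- rewrite leq_eqVlt => /orP [/eqP ->|mL]; first exact: subsetUr.
  by apply: subset_trans (@subsetUl _ _ _); apply: YP; rewrite m0.
- rewrite fset_setU // cardfsU big_ord_recr /=; apply: leq_trans (leq_subr _ _) _.
  apply: leq_add => //=; exact: (@card_fset_set_image _ _
    (orbit_point beta_gt1 L.+1) _ (S L.+1) (finS _) (@subset_refl _ _)).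
Qed.

(** The words relevant for the ball of radius [n] are those of length at most
    [n / ln beta]. The linear bound on that length, with an integer factor, makes it
    a polynomial factor in the count. *)
Lemma max_level : exists2 q : nat, (0 < q)%N & forall n : nat, exists L : nat,
  (L <= q * n)%N /\ forall m : nat, (m%:R * ln beta <= n%:R) = (m <= L)%N.
Proof.
pose q := Num.bound (ln beta)^-1.
have qP : (ln beta)^-1 < q%:R by apply: Num.Theory.archi_boundP; rewrite invr_ge0 ltW.
exists q; first by rewrite -(ltr0n R) (lt_trans _ qP) // invr_gt0.
move=> n; have ubd m : m%:R * ln beta <= n%:R -> (m <= q * n)%N.
  rewrite -ler_pdivlMr // => h; rewrite -(ler_nat R) natrM mulrC.
  by apply: le_trans h _; rewrite ler_wpM2l // ltW.
have ex0 : exists m : nat, m%:R * ln beta <= n%:R by exists 0%N; rewrite mul0r.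
have [L LP Lmax] := ex_maxnP ex0 ubd.
exists L; split=> [|m]; first exact: ubd.
apply/idP/idP => [/Lmax //|mL]; apply: le_trans LP.
by rewrite ler_wpM2r ?ler_nat // ltW.
Qed.

Let ball_sub L n : (forall m : nat, (m%:R * ln beta <= n%:R) = (m <= L)%N) ->
  exists2 Y : set (H3 R), finite_set Y /\ ball n `<=` Y &
    (#|` fset_set Y| <= \sum_(i < L) N i.+1)%N.
Proof.
move=> LP; have [Y [finY YP cardY]] := levels L; exists Y => //; split=> //.
move=> x [/(base_orbitP _ beta_gt1) [m m0 xm] xn]; apply: (YP m _ _ xm).
rewrite m0 -LP; apply: le_trans xn; case: xm => s _ <-.
exact: dist_orbit_point_ge.
Qed.

Lemma finite_orbit_ball n : finite_set (ball n).
Proof.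
have [q _ /(_ n) [L [_ LP]]] := max_level.
by have [Y [finY sub] _] := ball_sub LP; exact: sub_finite_set sub finY.
Qed.

Lemma orbit_ball_ge (C : R) m n : (0 < m)%N -> (forall s, S m s -> `|s| <= C) ->
  m%:R * ln beta + ln (C ^+ 2 + 2) <= n%:R -> (N m <= #|` fset_set (ball n)|)%N.
Proof.
move=> m0 SC mn.
rewrite -(card_fset_set_image_inj (@orbit_point_inj _ _ beta_gt1 m)) //.
apply: fsubset_leq_card; rewrite -fset_set_sub; first last.
- exact: finite_orbit_ball.
- exact: finite_image.
move=> _ [s Ss <-]; split; first by apply/base_orbitP; exists m => //; exists s.
by apply: le_trans mn; apply: dist_orbit_point_le; exact: SC.
Qed.

(** Summing over the at most [q * n] levels that meet the ball of radius [n], where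
    [beta ^ m <= exp n], gives a polynomial in [n] times [exp (t n)], and the
    polynomial is absorbed by [exp (eps n)]. *)
Lemma critical_exponent_le (t : R) (K e : nat) : 0 <= t ->
  (forall m, (0 < m)%N -> (N m)%:R <= (K * m ^ e).+1%:R * (beta ^+ m) `^ t) ->
  (critical_exponent Gamma <= t%:E)%E.
Proof.
move=> t0 NP; apply/lee_addgt0Pr => eps eps0.
have [q q0 qP] := max_level; have [D D0 DP] := poly_le_expR e eps0.
pose D' := (K.+1 * q ^ e.+1)%:R * D + 1 : R.
have D'1 : 1 <= D' by rewrite lerDr mulr_ge0 // ltW.
rewrite -EFinD; apply: (growth_rate_le _ D'1) => [|n n0].
  by rewrite addr_ge0 // ltW.
have [L [Lq LP]] := qP n; have [Y [finY sub] cardY] := ball_sub LP.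
have qn0 : (0 < q * n)%N by rewrite muln_gt0 q0.
apply: (@le_trans _ _ ((q * n)%:R * ((K.+1 * (q * n) ^ e)%:R * expR (t * n%:R)))).
  apply: (@le_trans _ _ (\sum_(i < L) N i.+1)%:R).
    rewrite ler_nat; apply: leq_trans cardY; apply: fsubset_leq_card.
    by rewrite -fset_set_sub //; exact: finite_orbit_ball.
  rewrite natr_sum.
  apply: (@le_trans _ _ (\sum_(i < L) ((K.+1 * (q * n) ^ e)%:R * expR (t * n%:R)))).
    apply: ler_sum => i _; apply: le_trans (NP i.+1 isT) _.
    have iL : (i.+1 <= L)%N by [].
    have leq_exp : (i.+1 ^ e <= (q * n) ^ e)%N.
      by have [->|e0] := posnP e; rewrite ?expn0 // leq_exp2r // (leq_trans iL).
    rewrite ler_pM ?powR_ge0 //.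
      rewrite ler_nat mulSn addnC -addn1 leq_add ?expn_gt0 ?qn0 //.
      by rewrite leq_mul // leq_exp.
    rewrite /powR gt_eqF ?exprn_gt0 ?(lt_trans _ beta_gt1) // ler_expR.
    rewrite ler_wpM2l // lnXn ?(lt_trans _ beta_gt1) // -[ln beta *+ _]mulr_natl.
    by rewrite LP.
  by rewrite sumr_const card_ord -[leLHS]mulr_natl ler_wpM2r ?ler_nat.
rewrite (mulrDl t eps) expRD.
apply: (@le_trans _ _ ((K.+1 * q ^ e.+1)%:R * (n%:R ^+ e.+1) * expR (t * n%:R))).
  rewrite le_eqVlt; apply/orP; left; apply/eqP.
  by rewrite !natrM !natrX !natrM !exprMn !exprS; ring.
rewrite [expR (t * _) * _]mulrC !mulrA ler_wpM2r ?expR_ge0 //.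
apply: (@le_trans _ _ ((K.+1 * q ^ e.+1)%:R * D * expR (eps * n%:R))).
  by rewrite -mulrA ler_wpM2l.
by rewrite ler_wpM2r ?expR_ge0 // /D' lerDl.
Qed.

End Counting.

(** * Upper bound for the dimension *)

(** Box-counting upper bound: the [n] sets of diameter at most [r] are completed by
    empty sets to a countable cover with sum at most [n * r `^ s]. *)
Lemma hausdorff_dim_le_uniform_covers (R : realType) (X : Type) (dX : X -> X -> R)
    (E : set X) (s : R) :
  0 < s -> (forall x y, 0 <= dX x y) ->
  (forall eps, 0 < eps -> exists n r (U : nat -> set X),
     [/\ 0 <= r <= eps, n%:R * r `^ s <= eps,
         E `<=` \bigcup_(i in [set i | (i < n)%N]) U i &
         forall i x y, U i x -> U i y -> dX x y <= r]) ->
  (hausdorff_dim dX E <= s%:E)%E.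
Proof.
move=> s0 dX0 covers; apply: ereal_inf_lbound; exists s => //; split; first exact: ltW.
have dp0 U : (0 <= diameter_pow dX s U)%E.
  by rewrite /diameter_pow; case: ifP => // _; exact: poweR_ge0.
have pre0 delta : (0 <= hausdorff_premeasure dX s delta E)%E.
  by apply: le_ereal_inf_tmp => _ [U _ <-]; apply: nneseries_ge0.
apply/eqP; rewrite eq_le; apply/andP; split; last first.
  by apply: le_trans (pre0 1) _; apply: ereal_sup_ubound; exists 1; rewrite /= ?ltr01.
apply: ge_ereal_sup => _ [delta /= delta0 <-]; apply/lee_addgt0Pr => eta eta0.
rewrite add0e; have e0 : 0 < Num.min delta eta by rewrite lt_min delta0.
have [n [r [U [/andP [r0]]]]] := covers _ e0.
rewrite !le_min => /andP [rd _] /andP [_ nr] EU UP.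
pose V i := if (i < n)%N then U i else set0.
have diam0 : diameter dX set0 = -oo%E.
  rewrite /diameter (_ : [set _ | _ in _ & _ in _] = set0) ?ereal_sup0 //.
  by apply/seteqP; split => // y [? []].
have diamV i : (diameter dX (V i) <= r%:E)%E.
  rewrite /V; case: ifP => _; last by rewrite diam0 leNye.
  by apply: ge_ereal_sup => _ [x Ux [y Uy <-]]; rewrite lee_fin; exact: UP Ux Uy.
have dpV i : (diameter_pow dX s (V i) <= (if (i < n)%N then r `^ s else 0)%:E)%E.
  rewrite /diameter_pow /V; case: ltnP => ni; last by rewrite eqxx.
  case: ifPn => [_|/set0P [x Ux]]; first by rewrite lee_fin powR_ge0.
  have := diamV i; rewrite /V ni => dU; rewrite -poweR_EFin.
  have d0 : (0 <= diameter dX (U i))%E.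
    apply: (@le_trans _ _ (dX x x)%:E); first by rewrite lee_fin.
    by apply: ereal_sup_ubound; exists x => //; exists x.
  by apply: gt0_ler_poweR => //; rewrite ?in_itv /= ?leey ?andbT // ?lee_fin; exact: ltW.
apply: (@le_trans _ _ (\sum_(0 <= i <oo) diameter_pow dX s (V i))%E).
  apply: ereal_inf_lbound; exists V => //; split=> [x /EU [i /= ni Uix]|i].
    by exists i => //; rewrite /V ni.
  by apply: le_trans (diamV i) _; rewrite lee_fin.
apply: (@le_trans _ _ (\sum_(0 <= i <oo) (if (i < n)%N then r `^ s else 0)%:E)%E).
  by apply: lee_nneseries.
rewrite (nneseries_split 0 n) => [|k _]; last first.
  by rewrite lee_fin; case: ifP => // _; exact: powR_ge0.
rewrite [X in (_ + X)%E]eseries0 => [|i]; last by rewrite add0n leqNgt => /negbTE ->.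
rewrite adde0 add0n big_mkord sumEFin lee_fin.
rewrite (eq_bigr (fun=> r `^ s)) => [|i _]; last by rewrite ltn_ord.
by rewrite sumr_const card_ord -mulr_natl.
Qed.

Section UpperBound.
Variables (R : realType) (beta : R) (A : set R).
Hypotheses (beta_gt1 : 1 < beta) (finA : finite_set A).
Local Notation S := (digit_sums beta A).
Local Notation N m := (#|` fset_set (S m)|).
Local Notation Gamma := (salem_semigroup beta (real_complex R @` A)).

Let beta_gt0 : 0 < beta. Proof. exact: lt_trans beta_gt1. Qed.
Let lnb_gt0 : 0 < ln beta. Proof. by rewrite ln_gt0. Qed.

(** All points of level [m] lie in the ball of radius [m ln beta + O (1)]. *)
Lemma card_digit_sums_le (s : R) : (critical_exponent Gamma < s%:E)%E ->
  exists2 K : R, 0 < K & exists m0 : nat, forall m, (m0 <= m)%N ->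
    (N m)%:R <= K * (beta ^+ m) `^ s.
Proof.
move=> cs; have s0 : 0 <= s.
  by rewrite -lee_fin; apply: le_trans (ltW cs); exact: growth_rate_ge0.
have [n0 n00 n0P] := growth_rate_lt cs.
have [C C0 SC] := digit_sums_bounded beta_gt1 finA.
pose c0 := ln (C ^+ 2 + 2).
have c00 : 0 <= c0 by apply: ln_ge0; have := sqr_ge0 C; lra.
exists (expR (s * (c0 + 1))); first exact: expR_gt0.
exists (Num.truncn (n0%:R / ln beta)).+1 => m mm0.
have m0 : (0 < m)%N by apply: leq_trans mm0.
have mn0 : n0%:R <= m%:R * ln beta.
  rewrite -ler_pdivrMr //; apply: le_trans (ltW (truncnS_gt _)) _.
  by rewrite ler_nat.
have ml0 : 0 <= m%:R * ln beta + c0 by rewrite addr_ge0 // mulr_ge0 // ltW.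
pose n := (Num.truncn (m%:R * ln beta + c0)).+1.
have nlt : m%:R * ln beta + c0 <= n%:R by rewrite ltW // truncnS_gt.
have nge : n%:R <= m%:R * ln beta + c0 + 1.
  by rewrite /n -natr1 lerD2r truncn_le.
have n0n : (n0 <= n)%N.
  by rewrite -(ler_nat R); apply: le_trans mn0 _; apply: le_trans nlt; rewrite lerDl.
apply: (@le_trans _ _ (expR (s * n%:R))).
  apply: le_trans (n0P _ n0n); rewrite ler_nat.
  by apply: (orbit_ball_ge beta_gt1 finA m0 _ nlt) => t; exact: SC.
rewrite /powR gt_eqF ?exprn_gt0 // -expRD ler_expR -mulrDr ler_wpM2l //.
by rewrite lnXn // -[ln beta *+ _]mulr_natl; apply: le_trans nge _; lra.
Qed.

Lemma hausdorff_dim_limit_set_le :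
  (boundary_hausdorff_dim (limit_set Gamma) <= critical_exponent Gamma)%E.
Proof.
have crit0 : (0 <= critical_exponent Gamma)%E.
  exact: growth_rate_ge0.
case critE : (critical_exponent Gamma) crit0 => [r| |] crit0;
  [|exact: leey|by rewrite leeNy_eq in crit0].
have r0 : 0 <= r by rewrite -lee_fin.
apply/lee_addgt0Pr => e e0; rewrite -EFinD.
have [C C0 SC] := digit_sums_bounded beta_gt1 finA.
have [|K K0 [m0 NK]] := @card_digit_sums_le (r + e / 2).
  by rewrite critE lte_fin ltrDl divr_gt0.
have re0 : 0 < r + e by rewrite ltr_wpDl.
apply: hausdorff_dim_le_uniform_covers => // [z w|eps eps0]; first exact: normc_ge0.
pose D := 2 * (C + 1); have D0 : 0 < D by rewrite mulr_gt0 // addr_gt0.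
have bV : 0 <= beta^-1 < 1 by rewrite invr_ge0 ltW //= invf_lt1.
(* The margin [e / 2] between the growth rate of [N m] and the exponent makes the
   sums decay like [gam ^+ m]. *)
pose gam := beta `^ (- (e / 2)).
have gam01 : 0 <= gam < 1.
  rewrite powR_ge0 /= /gam powRN invf_lt1 ?powR_gt0 //.
  by rewrite /powR gt_eqF // expR_gt1 mulr_gt0 // divr_gt0.
have KD0 : 0 < K * D `^ (r + e) by rewrite mulr_gt0 // powR_gt0.
have [k1 k1P] := exists_expr_lt bV (divr_gt0 eps0 D0).
have [k2 k2P] := exists_expr_lt gam01 (divr_gt0 eps0 KD0).
pose m := (m0 + k1 + k2)%N.
have decr q k : 0 <= q < 1 -> (k <= m)%N -> q ^+ m <= q ^+ k :> R.
  move=> /andP [q0 q1] km; rewrite -(subnKC km) exprD ler_piMr ?exprn_ge0 //.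
  by rewrite exprn_ile1 // ltW.
have k1m : (k1 <= m)%N by rewrite /m -addnA addnCA leq_addr.
have k2m : (k2 <= m)%N by rewrite /m leq_addl.
have m0m : (m0 <= m)%N by rewrite /m -addnA leq_addr.
have bm0 : 0 < beta ^+ m by rewrite exprn_gt0.
have h0 : 0 < (beta ^+ m)^-1 by rewrite invr_gt0.
pose fs : seq R := fset_set (S m).
exists (size fs), (D / beta ^+ m),
  (fun i => [set z | normc (z - (fs`_i)%:C) <= (C + 1) / beta ^+ m]); split.
- apply/andP; split; first by rewrite mulr_ge0 // ltW.
  rewrite mulrC -ler_pdivlMr //.
  by apply: le_trans (ltW k1P); rewrite -exprVn decr.
- apply: (@le_trans _ _ (K * (beta ^+ m) `^ (r + e / 2) * (D / beta ^+ m) `^ (r + e))).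
    by rewrite ler_wpM2r ?powR_ge0 // NK.
  rewrite powRM ?(ltW D0) ?(ltW h0) //.
  have -> : ((beta ^+ m)^-1) `^ (r + e) = (beta ^+ m) `^ (- (r + e)).
    by rewrite -powR_inv1 ?(ltW bm0) // -powRrM mulN1r.
  rewrite mulrACA -powRD ?(gt_eqF bm0) ?implybT //.
  have -> : r + e / 2 - (r + e) = - (e / 2) by field.
  have -> : (beta ^+ m) `^ (- (e / 2)) = gam ^+ m.
    by rewrite -[beta ^+ m]powR_mulrn ?(ltW beta_gt0) // powRAC powR_mulrn ?powR_ge0.
  rewrite mulrC -ler_pdivlMr //; apply: le_trans (ltW k2P).
  exact: decr.
- move=> z Lz; have [s Ss zs] := limit_set_cover beta_gt1 m (fun k s => @SC k s) Lz.
  have sfs : s \in fs by rewrite in_fset_set ?inE //; exact: finite_digit_sums.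
  exists (index s fs); first by rewrite /= index_mem.
  by rewrite /= nth_index.
- move=> i z w /= zi wi.
  rewrite (_ : z - w = (z - (fs`_i)%:C) + - (w - (fs`_i)%:C)); last by ring.
  apply: le_trans (le_normcD _ _) _; rewrite normcN.
  by apply: le_trans (lerD zi wi) _; rewrite /D; lra.
Qed.

End UpperBound.

(** * Hausdorff measure of coded Cantor sets *)

Section Kraft.
Variables (R : realType) (T : finType) (w : nat -> seq T).
Local Open Scope ereal_scope.

Let q : R := (#|T|%:R^-1)%R.

Let weight (v : seq T) : \bar R :=
  \sum_(0 <= n <oo) (if prefix v (w n) then q ^+ size (w n) else 0)%R%:E.

Let q_ge0 : (0 <= q)%R. Proof. by rewrite invr_ge0. Qed.

Let weight_term_ge0 v n :
  0 <= (if prefix v (w n) then q ^+ size (w n) else 0)%R%:E :> \bar R.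
Proof. by rewrite lee_fin; case: ifP => // _; rewrite exprn_ge0. Qed.

Let sum_children_le v : \sum_(c : T) weight (rcons v c) <= weight v.
Proof.
rewrite /weight -nneseries_sum; last by move=> c n _; exact: weight_term_ge0.
apply: lee_nneseries => [n _ _|n _]; first by apply: sume_ge0 => c _.
have [/existsP [c pc]|nopref] := boolP [exists c, prefix (rcons v c) (w n)].
  rewrite (bigD1 c) //= big1 ?adde0 => [|c' cc'].
    rewrite pc ifT //; exact: prefix_trans (prefix_rcons _ _) pc.
  rewrite ifF //; apply: contra_neqF cc'; move: pc; rewrite !prefixE !size_rcons.
  by move=> /eqP -> /eqP/rcons_inj [].
by rewrite big1 // => c _; rewrite ifF //; apply: contraNF nopref => pc; apply/existsP; exists c.
Qed.

Hypothesis T_gt0 : (0 < #|T|)%N.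
Hypothesis sum_lt1 : \sum_(0 <= n <oo) (q ^+ size (w n))%:E < 1.

Let light_child v : exists c, weight v < (q ^+ size v)%:E ->
  weight (rcons v c) < (q ^+ size (rcons v c))%:E.
Proof.
apply: contrapT => noc; have heavy c : ~ (weight v < (q ^+ size v)%:E ->
    weight (rcons v c) < (q ^+ size (rcons v c))%:E).
  by move=> h; apply: noc; exists c.
have /card_gt0P [c0 _] := T_gt0.
have vlt : weight v < (q ^+ size v)%:E by apply: contrapT => h; apply: (heavy c0).
suff : (q ^+ size v)%:E <= weight v by rewrite leNgt vlt.
apply: le_trans (sum_children_le v).
apply: (@le_trans _ _ (\sum_(c : T) (q ^+ (size v).+1)%:E)).
  rewrite sumEFin lee_fin sumr_const -mulr_natl exprS mulrA divff ?mul1r //.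
  by rewrite pnatr_eq0 -lt0n.
apply: lee_sum => c _; rewrite leNgt; apply/negP => h; apply: (heavy c) => _.
by rewrite size_rcons.
Qed.

(** The infinite word is followed letter by letter. The weight of a finite word [v]
    is the part of the sum carried by the [w n] that extend [v]. The weights of the
    children of [v] add up to at most that of [v], so if the weight of [v] is less
    than [q ^+ size v], some child inherits this property; but it fails for [v = w n]. *)
Lemma kraft_avoid : exists s : nat -> T, forall n, mkseq s (size (w n)) <> w n.
Proof.
have [f fP] := choice light_child.
pose v k := iter k (fun u => rcons u (f u)) [::].
have szv k : size (v k) = k by elim: k => //= k IH; rewrite size_rcons IH.
have vE k : mkseq (fun i => f (v i)) k = v k.
  by elim: k => // k IH; rewrite mkseqS IH.
have wv k : weight (v k) < (q ^+ k)%:E.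
  elim: k => [|k IH].
    by rewrite /weight; under eq_eseriesr do rewrite prefix0s; rewrite expr0.
  by have := fP (v k); rewrite size_rcons szv; apply.
exists (fun i => f (v i)) => n; rewrite vE => vw.
have := wv (size (w n)); rewrite ltNge => /negP; apply.
apply: le_trans (nneseries_lim_ge n.+1 _); last by move=> k _ _; exact: weight_term_ge0.
rewrite big_nat_recr //= vw prefix_refl leeDr //.
by apply: sume_ge0 => k _.
Qed.

End Kraft.

(** A Cantor set coded by infinite words: points at distance less than [g * rho ^+ k]
    have the same first [k] digits, and the similarity dimension
    [ln #|T| / - ln rho] is at least [t]. *)
Section HausdorffLowerBound.
Variables (R : realType) (X : Type) (dX : X -> X -> R).
Variables (T : finType) (x : (nat -> T) -> X) (g rho t : R).
Hypotheses (g_gt0 : 0 < g) (rho_gt0 : 0 < rho) (rho_lt1 : rho < 1) (t_ge0 : 0 <= t).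
Hypotheses (T_gt1 : (1 < #|T|)%N) (T_big : 1 <= #|T|%:R * rho `^ t).
Hypothesis x_sep : forall s s' k, dX (x s) (x s') < g * rho ^+ k ->
  mkseq s k = mkseq s' k.

Let q : R := #|T|%:R^-1.
Let K : R := ((g * rho) `^ t)^-1.

Let q01 : 0 <= q < 1.
Proof. by rewrite invr_ge0 ler0n /= invf_lt1 ?ltr1n // ltr0n ltnW. Qed.

Let K_gt0 : 0 < K. Proof. by rewrite invr_gt0 powR_gt0 // mulr_gt0. Qed.

(** The scale [k] is the largest with diameter less than [g * rho ^+ k], so that the
    [t]-th power of the diameter controls [q ^+ k]. Sets of diameter 0 have no
    largest [k], which is why the error term [eta] is needed. *)
Let scale U (eta : R) : (diameter dX U <= (g / 2)%:E)%E -> 0 < eta ->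
  exists k, (diameter dX U < (g * rho ^+ k)%:E)%E /\
    ((q ^+ k)%:E <= K%:E * diameter_pow dX t U + eta%:E)%E.
Proof.
move=> Ug eta0; have grho k : 0 < g * rho ^+ k by rewrite mulr_gt0 // exprn_gt0.
have dp0 : (0 <= diameter_pow dX t U)%E.
  by rewrite /diameter_pow; case: ifP => // _; exact: poweR_ge0.
have [dU|dU] := leP (diameter dX U) 0%E.
  have [k kq] := exists_expr_lt q01 eta0; exists k; split.
    by apply: le_lt_trans dU _; rewrite lte_fin.
  apply: (@le_trans _ _ eta%:E); first by rewrite lee_fin ltW.
  by rewrite leeDr // mule_ge0 // lee_fin ltW.
have U0 : U != set0.
  apply: contraTneq dU => ->; rewrite /diameter -leNgt.
  rewrite (_ : [set _ | _ in _ & _ in _] = set0) ?ereal_sup0 //.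
  by apply/seteqP; split => // y [? []].
rewrite /diameter_pow (negPf U0); case dE : (diameter dX U) Ug dU => [r| |] //.
rewrite lee_fin lte_fin => rg r0.
have [k kP kmin] : exists2 k, g * rho ^+ k.+1 <= r & forall j, g * rho ^+ j.+1 <= r -> (k <= j)%N.
  have ex : exists k, g * rho ^+ k.+1 <= r.
    have rho01 : 0 <= rho < 1 by rewrite ltW.
    have [k kr] := exists_expr_lt rho01 (divr_gt0 r0 g_gt0).
    exists k; rewrite mulrC -ler_pdivlMr //; apply: le_trans (ltW kr).
    by rewrite exprS ler_piMl ?exprn_ge0 ?ltW.
  by have [k kP kmin] := ex_minnP ex; exists k.
exists k; split.
  rewrite lte_fin ltNge; apply/negP; case: k kP kmin => [|k] kP kmin.
    rewrite expr0 mulr1 => gr; move: (le_trans gr rg).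
    by apply/negP; rewrite -ltNge ltr_pdivrMr // ltr_pMr // ltr1n.
  by move/kmin; rewrite ltnn.
rewrite poweR_EFin -EFinM -EFinD lee_fin; apply: ler_wpDr; first exact: ltW.
have qrho : q <= rho `^ t.
  by rewrite /q -[_^-1]mul1r ler_pdivrMr ?ltr0n 1?ltnW // mulrC.
apply: (@le_trans _ _ ((rho `^ t) ^+ k)).
  by rewrite lerXn2r // nnegrE ?powR_ge0 //; case/andP: q01.
rewrite /K mulrC ler_pdivlMr ?powR_gt0 ?mulr_gt0 //.
rewrite -powR_mulrn ?powR_ge0 // powRAC powR_mulrn ?(ltW rho_gt0) //.
rewrite -powRM ?exprn_ge0 ?mulr_ge0 ?(ltW rho_gt0) ?(ltW g_gt0) //.
rewrite mulrCA -exprSr.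
apply: (ge0_ler_powR t_ge0); rewrite ?nnegrE ?(ltW r0) ?(ltW (grho _)) //.
Qed.

(** A set that meets the Cantor set determines the first [k] digits of its points. If
    the [t]-sum of a cover were small, these words would contradict the Kraft
    inequality: an infinite word that avoids them codes an uncovered point. *)
Lemma hausdorff_measure_neq0 (E : set X) :
  (forall s, E (x s)) -> hausdorff_measure dX t E != 0%E.
Proof.
move=> Ex; apply/eqP => HE0.
have /ereal_inf_lt [_ [U [cov Ug] <-] sumU] :
    (hausdorff_premeasure dX t (g / 2) E < (K^-1 / 2)%:E)%E.
  apply: (@le_lt_trans _ _ 0%E); last first.
    by rewrite lte_fin divr_gt0 // invr_gt0; exact: K_gt0.
  rewrite -HE0; apply: ereal_sup_ubound; exists (g / 2) => //=.
  by rewrite divr_gt0.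
have eta0 n : 0 < (2^-1 : R) / (2 ^ n.+1)%:R.
  by rewrite divr_gt0 ?invr_gt0 // ltr0n expn_gt0.
have [k kP] := choice (fun n => scale (Ug n) (eta0 n)).
have word n : exists w, size w = k n /\ forall s, U n (x s) -> mkseq s (k n) = w.
  have [[s Us]|noU] := pselect (exists s, U n (x s)).
    exists (mkseq s (k n)); split=> [|s' Us']; first by rewrite size_mkseq.
    apply: x_sep; rewrite -lte_fin; apply: le_lt_trans (kP n).1.
    by apply: ereal_sup_ubound; exists (x s') => //; exists (x s).
  have /card_gt0P [c _] : (0 < #|T|)%N by apply: ltnW.
  exists (nseq (k n) c); split=> [|s Us]; first by rewrite size_nseq.
  by case: noU; exists s.
have [w wP] := choice word.
have dp0 n : (0 <= diameter_pow dX t (U n))%E.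
  by rewrite /diameter_pow; case: ifP => // _; exact: poweR_ge0.
have [||s sP] := @kraft_avoid R T w; first exact: ltnW.
  apply: (@le_lt_trans _ _ (K%:E * \sum_(0 <= n <oo) diameter_pow dX t (U n) + (2^-1)%:E)%E).
    rewrite -nneseriesZl //; apply: le_trans (epsilon_trick _ _ _).
    - apply: lee_nneseries => [n _ _|n _].
        by rewrite lee_fin exprn_ge0 // invr_ge0.
      by rewrite (wP n).1; exact: (kP n).2.
    - by move=> n; rewrite mule_ge0 // lee_fin ltW.
    - by rewrite invr_ge0.
  apply: (@lt_le_trans _ _ (K%:E * (K^-1 / 2)%:E + (2^-1)%:E)%E).
    by rewrite lteD2rE // lte_pmul2l.
  rewrite -EFinM -EFinD lee_fin mulrA divff ?gt_eqF // mul1r.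
  by rewrite le_eqVlt; apply/orP; left; apply/eqP; field.
have [n _ Un] := cov _ (Ex s).
by apply: (sP n); rewrite (wP n).1; exact: (wP n).2.
Qed.

End HausdorffLowerBound.

(** * Lower bound for the dimension *)

Lemma card_fset_le_classes (R : realType) (T : choiceType) (X : {fset T}) (q : nat)
    (h : T -> 'I_q) (D : R) :
  (forall j, #|` [fset x in X | h x == j]%fset|%:R <= D) ->
  #|` X|%:R <= q%:R * D.
Proof.
move=> classD.
have -> : #|` X|%:R = \sum_(j < q) #|` [fset x in X | h x == j]%fset|%:R :> R.
  rewrite -natr_sum; congr (_%:R).
  rewrite card_fset_sum1 (partition_big h xpredT) //=.
  by apply: eq_bigr => j _; rewrite card_fset_sum1 big_fset_condE.
apply: le_trans (ler_sum _ (fun j _ => classD j)) _.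
by rewrite sumr_const card_ord mulr_natl.
Qed.

(** Distance at least 1 forces different integer parts, and equal residues then
    force integer parts that differ by at least [q]. *)
Lemma truncn_mod_separated (R : realType) (q : nat) (x y : R) :
  (0 < q)%N -> 0 <= x -> 0 <= y -> Num.truncn x = Num.truncn y %[mod q] ->
  1 <= `|x - y| -> q%:R - 1 < `|x - y|.
Proof.
move=> q0; wlog xy : x y / y <= x => [H|] x0 y0 mod1 sep.
  have [yx|/ltW xy] := leP y x; first exact: H.
  by rewrite distrC; apply: H => //; rewrite distrC.
have nE : `|x - y| = x - y by rewrite ger0_norm // subr_ge0.
rewrite nE in sep *.
have /andP [xl xu] := truncn_itv x0; have /andP [yl yu] := truncn_itv y0.
set a := Num.truncn x in mod1 xl xu; set b := Num.truncn y in mod1 yl yu.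
have ba : (b < a)%N by rewrite truncn_ge_nat // -natr1; lra.
have qab : (q <= a - b)%N.
  have : (q %| a - b)%N by rewrite -eqn_mod_dvd ?(ltnW ba) //; apply/eqP.
  by move/dvdn_leq; apply; rewrite subn_gt0.
have : q%:R + b%:R <= a%:R :> R.
  by rewrite -natrD ler_nat addnC -leq_subRL ?(ltnW ba).
have : b.+1%:R = b%:R + 1 :> R by rewrite -natr1.
lra.
Qed.

(** Expansions in base [1 / rho] with digits [d]. Only the bound and the recursion
    under the shift are used afterwards, so the series itself is hidden. *)
Lemma digit_expansion (R : realType) (T : Type) (d : T -> R) (rho B : R) :
  0 <= rho < 1 -> (forall c, `|d c| <= B * (1 - rho)) ->
  exists x : (nat -> T) -> R, forall s,
    `|x s| <= B /\ x s = d (s 0%N) + rho * x (fun i => s i.+1).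
Proof.
move=> /andP [rho0 rho1] dB.
pose u (s : nat -> T) i := d (s i) * rho ^+ i.
have cvgu s : cvgn (series (u s)).
  apply: normed_cvg; apply: (@series_le_cvg _ _ (geometric (B * (1 - rho)) rho)).
  - by move=> n; exact: normr_ge0.
  - by move=> n; rewrite /= mulr_ge0 ?exprn_ge0 // (le_trans _ (dB (s 0%N))).
  - by move=> n; rewrite /= normrM (ger0_norm (exprn_ge0 n rho0)) ler_wpM2r ?exprn_ge0.
  - by apply: is_cvg_geometric_series; rewrite ger0_norm.
have seriesS s n : series (u s) n.+1 = d (s 0%N) + rho * series (u (fun i => s i.+1)) n.
  rewrite /series /= big_nat_recl // /u expr0 mulr1 mulr_sumr; congr (_ + _).
  by apply: eq_bigr => i _; rewrite exprS mulrCA.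
have B0 (s : nat -> T) : 0 <= B.
  have := le_trans (normr_ge0 _) (dB (s 0%N)).
  by rewrite pmulr_lge0 // subr_gt0.
exists (fun s => limn (series (u s))) => s; split.
  have ser_le n : forall s, `|series (u s) n| <= B.
    elim: n => [|n IH] s'; first by rewrite /series /= big_geq // normr0 (B0 s').
    rewrite seriesS; apply: le_trans (ler_normD _ _) _.
    apply: (@le_trans _ _ (B * (1 - rho) + rho * B)); last first.
      by rewrite le_eqVlt; apply/orP; left; apply/eqP; ring.
    by rewrite lerD // normrM ger0_norm // ler_wpM2l.
  rewrite ler_norml; apply/andP; split.
    apply: limr_ge; first exact: cvgu.
    by near=> n; have := ser_le n s; rewrite ler_norml => /andP [].
  apply: limr_le; first exact: cvgu.
  by near=> n; have := ser_le n s; rewrite ler_norml => /andP [].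
apply/cvg_lim => //; rewrite -(cvg_shiftS (series (u s))).
have -> : [sequence series (u s) n.+1]_n =
    (fun n => d (s 0%N) + rho * series (u (fun i => s i.+1)) n).
  by apply/funext => n; exact: seriesS.
by apply: cvgD; [exact: cvg_cst|apply: cvgMr; exact: cvgu].
Unshelve. all: by end_near.
Qed.

Section LowerBound.
Variables (R : realType) (beta : R) (A : set R).
Hypotheses (beta_gt1 : 1 < beta) (finA : finite_set A).
Local Notation S := (digit_sums beta A).
Local Notation N m := (#|` fset_set (S m)|).
Local Notation Gamma := (salem_semigroup beta (real_complex R @` A)).

Let beta_gt0 : 0 < beta. Proof. exact: lt_trans beta_gt1. Qed.
Let beta_neq0 : beta != 0. Proof. by rewrite gt_eqF. Qed.

(** Expansions in base [beta ^+ m] with digits in [T] are limits of digit sums, and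
    are bounded by [B]. If two of them first differ at index [i], their distance is
    more than [rho ^+ i * (4 * B * rho - rho * (2 * B))] with [rho = beta ^- m], which
    is the separation required of a coded Cantor set with [g = 2 * B]. *)
Lemma hausdorff_limit_set_neq0 (B t : R) (m : nat) (T : {fset R}) :
  0 <= t -> (0 < m)%N -> 0 < B ->
  (forall s, s \in T -> S m s /\ `|s| <= B * (1 - beta^-1)) ->
  (forall s s', s \in T -> s' \in T -> s != s' -> 4 * B / beta ^+ m < `|s - s'|) ->
  (beta ^+ m) `^ t < #|` T|%:R ->
  hausdorff_measure (fun z w : R[i] => normc (z - w)) t
    [set z | limit_set Gamma (Some z)] != 0%E.
Proof.
move=> t0 m0 B0 TS Tsep Tcard.
have bm0 : 0 < beta ^+ m by rewrite exprn_gt0.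
pose rho := (beta ^+ m)^-1; have rho0 : 0 < rho by rewrite invr_gt0.
have rhob : rho <= beta^-1.
  by rewrite lef_pV2 ?posrE // -[leLHS]expr1 ler_eXn2l.
have rho1 : rho < 1 by apply: le_lt_trans rhob _; rewrite invf_lt1.
have rho01 : 0 <= rho < 1 by rewrite (ltW rho0).
have dB (c : T) : `|fsval c| <= B * (1 - rho).
  apply: le_trans (TS _ (fsvalP c)).2 _; rewrite ler_wpM2l ?(ltW B0) //.
  by rewrite lerB.
have [x xP] := digit_expansion rho01 dB.
have powm0 : 1 <= (beta ^+ m) `^ t.
  by rewrite -[1](powRr0 (beta ^+ m)) ler_powR // exprn_ege1 // ltW.
apply: (@hausdorff_measure_neq0 R _ _ T (fun s => (x s)%:C) (2 * B) rho t) => //.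
- by rewrite mulr_gt0.
- by rewrite -(ltr1n R) -cardfE; apply: le_lt_trans Tcard.
- rewrite -cardfE; apply: (@le_trans _ _ ((beta ^+ m) `^ t * rho `^ t)).
    by rewrite -powRM ?(ltW bm0) ?(ltW rho0) // divff ?gt_eqF // powR1.
  by rewrite ler_wpM2r ?powR_ge0 // ltW.
- move=> s s' k; rewrite -rmorphB normc_real.
  elim: k s s' => [//|k IH] s s'.
  have [_ xs] := xP s; have [_ xs'] := xP s'.
  set y := x (fun i => s i.+1) in xs; set y' := x (fun i => s' i.+1) in xs'.
  have yy' : `|y - y'| <= 2 * B.
    apply: le_trans (ler_normB _ _) _.
    have := (xP (fun i => s i.+1)).1; have := (xP (fun i => s' i.+1)).1.
    by rewrite -/y -/y'; lra.
  have [ss|ss] := eqVneq (s 0%N) (s' 0%N).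
    rewrite xs xs' ss opprD addrACA subrr add0r -mulrBr normrM (gtr0_norm rho0).
    rewrite exprS mulrCA ltr_pM2l // => /IH mk.
    rewrite /mkseq /= -[1%N]addn0 !iotaDl -!map_comp ss; congr (_ :: _).
    exact: mk.
  have vss : fsval (s 0%N) != fsval (s' 0%N) by rewrite (inj_eq val_inj).
  have := Tsep _ _ (fsvalP (s 0%N)) (fsvalP (s' 0%N)) vss; rewrite -/rho => sep.
  move=> lt; exfalso; move: lt; apply/negP; rewrite -leNgt.
  apply: (@le_trans _ _ (2 * B * rho)).
    by rewrite exprS ler_wpM2l ?mulr_ge0 ?(ltW B0) // ler_piMr ?(ltW rho0) // exprn_ile1 // ltW.
  rewrite xs xs' (_ : _ - _ = (fsval (s 0%N) - fsval (s' 0%N)) - rho * (y' - y)); last by ring.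
  apply: le_trans (lerB_dist _ _).
  rewrite normrM (gtr0_norm rho0).
  have : rho * `|y - y'| <= rho * (2 * B) by rewrite ler_wpM2l // ltW.
  by rewrite (distrC y' y); lra.
- move=> s; apply: (@limit_set_contains _ _ _ beta_gt1 B).
  have approx k : forall s, exists2 r, S (k * m) r & `|r - x s| <= B / beta ^+ (k * m).
    elim: k => [|k IH] {}s.
      exists 0; first by rewrite mul0n.
      by rewrite mul0n expr0 divr1 sub0r normrN; exact: (xP s).1.
    have [r Sr rx] := IH (fun i => s i.+1).
    exists (fsval (s 0%N) + r / beta ^+ m).
      by rewrite mulSn; apply: digit_sumsD => //; exact: (TS _ (fsvalP _)).1.
    rewrite (xP s).2 opprD addrACA subrr add0r [r / _]mulrC -mulrBr normrM.
    rewrite (gtr0_norm rho0) mulSn exprD invfM mulrCA ler_wpM2l //.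
    exact: ltW.
  move=> k; have [r Sr rx] := approx k s; exists (k * m)%N, r; split=> //.
  by rewrite leq_pmulr.
Qed.

(** Put [dl] for the separation of [digit_sums beta A m]. Sorting the digit sums by
    the integer part of [(s + C) / dl] modulo [q] makes the elements of one class
    more than [(q - 1) * dl] apart, and [q] is chosen so that this exceeds
    [4 * B / beta ^+ m]. If one class had more than [(beta ^+ m) `^ t] elements, the
    [t]-dimensional measure of the limit set would not vanish. *)
Lemma critical_exponent_le_of_separated (c t : R) (e : nat) :
  0 < c -> (forall m s s', (0 < m)%N -> S m s -> S m s' -> s != s' ->
    c / (beta ^+ m * m%:R ^+ e) <= `|s - s'|) ->
  0 <= t ->
  hausdorff_measure (fun z w : R[i] => normc (z - w)) t
    [set z | limit_set Gamma (Some z)] = 0%E ->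
  (critical_exponent Gamma <= t%:E)%E.
Proof.
move=> c0 sep t0 H0.
have [C C0 SC] := digit_sums_bounded beta_gt1 finA.
have bV1 : 0 < 1 - beta^-1 by rewrite subr_gt0 invf_lt1.
pose B := C / (1 - beta^-1); have B0 : 0 < B by rewrite divr_gt0.
pose K := Num.bound (4 * B / c).
have KP : 4 * B / c < K%:R.
  by apply: Num.Theory.archi_boundP; rewrite divr_ge0 ?(ltW c0) // mulr_ge0 // ltW.
apply: (@critical_exponent_le _ _ _ beta_gt1 finA t K e t0) => m m0.
set q := (K * m ^ e).+1.
apply: (@card_fset_le_classes _ _ _ q
  (fun s => inord (Num.truncn ((s + C) / (c / (beta ^+ m * m%:R ^+ e))) %% q))).
move=> j; rewrite leNgt; apply/negP => big.
have finS : finite_set (S m) by exact: finite_digit_sums.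
have mem s : s \in [fset x in fset_set (S m) | inord (Num.truncn
      ((x + C) / (c / (beta ^+ m * m%:R ^+ e))) %% q) == j]%fset ->
    S m s /\ (Num.truncn ((s + C) / (c / (beta ^+ m * m%:R ^+ e))) %% q)%N = j.
  rewrite !inE in_fset_set // => /andP [/set_mem Ss /eqP <-]; split=> //.
  by rewrite inordK // ltn_mod.
set dl := c / _ in big mem.
have bm0 : 0 < beta ^+ m by rewrite exprn_gt0.
have me0 : 0 < m%:R ^+ e :> R by rewrite exprn_gt0 // ltr0n.
have dl0 : 0 < dl by rewrite divr_gt0 // mulr_gt0.
move/eqP: H0; apply/negP.
apply: (hausdorff_limit_set_neq0 t0 m0 B0 _ _ big)
  => [s /mem [Ss _]|s s' /mem [Ss hs] /mem [Ss' hs'] ss'].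
  by split=> //; rewrite /B divfK ?gt_eqF //; exact: SC Ss.
have pos r : S m r -> 0 <= (r + C) / dl.
  move=> /SC; rewrite ler_norml => /andP [rC _]; rewrite divr_ge0 ?(ltW dl0) //.
  by rewrite -[X in _ + X]opprK subr_ge0.
have diffE : `|(s + C) / dl - (s' + C) / dl| = `|s - s'| / dl.
  by rewrite -mulrBl opprD addrACA subrr addr0 normrM normfV (gtr0_norm dl0).
have := @truncn_mod_separated _ q _ _ (ltn0Sn _) (pos _ Ss) (pos _ Ss').
rewrite hs hs' diffE => /(_ erefl); rewrite ler_pdivlMr // mul1r => /(_ (sep _ _ _ m0 Ss Ss' ss')).
rewrite ltr_pdivlMr // => h; apply: lt_trans h.
have -> : q%:R - 1 = (K * m ^ e)%:R :> R by rewrite /q -natr1 addrK.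
rewrite natrM natrX /dl.
have -> : K%:R * m%:R ^+ e * (c / (beta ^+ m * m%:R ^+ e)) = (K%:R * c) / beta ^+ m.
  by field; rewrite !gt_eqF.
by rewrite ltr_pM2r ?invr_gt0 // -ltr_pdivrMr.
Qed.

End LowerBound.

(** * Equality of dimension and critical exponent *)

Lemma rat_adjoin_real (R : realType) (x : R) (z : R[i]) :
  rat_adjoin x%:C z -> exists2 a : R, rat_adjoin x a & z = a%:C.
Proof.
have hornerC (p : {poly rat}) : (map_poly ratr p).[x%:C] = ((map_poly ratr p).[x])%:C.
  rewrite -horner_map -map_poly_comp; congr (_.[_]).
  by apply: eq_map_poly => r /=; rewrite fmorph_rat.
move=> [p [q [q0 ->]]]; exists ((map_poly ratr p).[x] / (map_poly ratr q).[x]).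
  by exists p, q; split=> //; apply: contraNneq q0 => q0; rewrite hornerC q0 rmorph0.
by rewrite !hornerC fmorph_div.
Qed.

Theorem mainTheorem3 (R : realType) (beta : R) (A : set R[i]) :
  salem beta ->
  finite_set A ->
  A `<=` rat_adjoin (real_complex R beta) ->
  boundary_hausdorff_dim (limit_set (salem_semigroup beta A)) =
  critical_exponent (salem_semigroup beta A).
Proof.
move=> sal finA AQ; have beta_gt1 : 1 < beta by case: sal.
pose A' : set R := [set complex.Re z | z in A].
have finA' : finite_set A' by exact: finite_image.
have AE : A = real_complex R @` A'.
  apply/seteqP; split=> [z Az|_ [_ [z Az <-] <-]].
    by have [a _ zE] := rat_adjoin_real (AQ _ Az); exists a => //; exists z => //; rewrite zE.
  by have [a _ zE] := rat_adjoin_real (AQ _ Az); rewrite zE in Az *.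
have A'Q : A' `<=` rat_adjoin beta.
  by move=> _ [z Az <-]; have [a aQ ->] := rat_adjoin_real (AQ _ Az).
have [c [e c0 sep]] := digit_sums_separated sal finA' A'Q.
rewrite AE; apply/eqP; rewrite eq_le; apply/andP; split.
  exact: hausdorff_dim_limit_set_le.
apply: le_ereal_inf_tmp => _ [t [t0 H0] <-].
exact: (critical_exponent_le_of_separated beta_gt1 finA' c0 sep t0 H0).
Qed.
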